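(* Let $\mathcal{M}$ be a class of matroids. If $\mathcal{M}$ contains all rank-$3$ uniform matroids, and is closed under principal extensions, then $\mathcal{M}$ is not pigeonhole.
   Context: All matroids are finite. Principal extension. Let $F$ be a flat of a matroid $M$, let $M'$ be a single-element extension of $M$, and let $e$ be the element of $E(M')-E(M)$. Then $M'$ is a principal extension of $M$ (relative to $F$) if $F$ spans $e$ in $M'$, $F\cup e$ is a flat of $M'$, and whenever $X\subseteq E(M)$ spans $e$ in $M'$, it spans $F\cup e$. For a matroid $M$ and $U\subseteq E(M)$, let $\lambda_M(U)=r_M(U)+r_M(E(M)-U)-r(M)$. For $X,X'\subseteq U$, write $X\sim_U X'$ if for every $Z\subseteq E(M)-U$, $X\cup Z$ is independent in $M$ iff $X'\cup Z$ is independent in $M$. A subcubic tree is a tree in which every vertex has degree three or one; degree-one vertices are leaves. A decomposition of $M$ is a pair $(T,\varphi)$ with $T$ a subcubic tree and $\varphi$ a bijection from $E(M)$ to the leaves of $T$. Deleting an edge $e$ of $T$ splits the leaves into two parts, giving a partition $(U_e,V_e)$ of $E(M)$; the sets $U_e$ and $V_e$ are displayed by $e$. The branch-width $\mathrm{bw}(M)$ is the minimum over decompositions $(T,\varphi)$ of the maximum of $\lambda_M(U_e)+1$ over edges $e$ of $T$. The decomposition-width $\mathrm{dw}(M)$ is the minimum over decompositions $(T,\varphi)$ of the maximum number of equivalence classes of $\sim_U$ over all sets $U$ displayed by an edge of $T$. A class $\mathcal{M}$ of matroids is pigeonhole if for every positive integer $\lambda$ there is an integer $\rho(\lambda)$ such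 that $\mathrm{bw}(M)\le\lambda$ implies $\mathrm{dw}(M)\le\rho(\lambda)$ for every $M\in\mathcal{M}$. *)

(* Defs.v *)
From mathcomp Require Import all_boot.
From mathcomp Require Import boolp.

Set Implicit Arguments.
Unset Strict Implicit.
Unset Printing Implicit Defensive.

(* The ground set is a subset of [T], not the whole type, so that a matroid
   and its single-element extensions can live over the same [T]. *)
Record matroid (T : finType) := Matroid {
  ground : {set T};
  indep : {set {set T}};
  indep_ground : forall X, X \in indep -> X \subset ground;
  indep_set0 : set0 \in indep;
  indep_hereditary : forall X Y : {set T}, X \subset Y -> Y \in indep -> X \in indep;
  indep_augment : forall X Y : {set T},
    X \in indep -> Y \in indep -> #|X| < #|Y| ->
    exists2 y, y \in Y :\: X & (y |: X) \in indep }.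

Section MatroidNotions.
Variables (T : finType) (M : matroid T).
Implicit Types (X U F Z : {set T}) (r : nat).

Definition rank X : nat := \max_(I in indep M | I \subset X) #|I|.

Definition closure X : {set T} :=
  [set x in ground M | rank (x |: X) == rank X].

Definition flat F : Prop := F \subset ground M /\ closure F = F.

Definition uniform r : Prop :=
  r <= #|ground M| /\
  forall X, (X \in indep M) = (X \subset ground M) && (#|X| <= r).

(* The truncated subtraction is harmless: by submodularity of the rank the
   difference is nonnegative when U \subset ground M. *)
Definition lambda U : nat :=
  rank U + rank (ground M :\: U) - rank (ground M).

Definition sim U : rel {set T} := fun X X' =>
  [forall (Z : {set T} | Z \subset ground M :\: U),
     (X :|: Z \in indep M) == (X' :|: Z \in indep M)].

Definition sim_classes U : nat :=
  #|equivalence_partition (sim U) (powerset U)|.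

End MatroidNotions.

Definition single_element_extension (T : finType)
    (M M' : matroid T) (e : T) : Prop :=
  [/\ e \notin ground M, ground M' = e |: ground M &
      forall X : {set T}, X \subset ground M ->
        (X \in indep M') = (X \in indep M)].

Definition principal_extension (T : finType) (M M' : matroid T) : Prop :=
  exists (F : {set T}) (e : T),
    [/\ flat M F, single_element_extension M M' e,
        e \in closure M' F, flat M' (e |: F) &
        forall X : {set T}, X \subset ground M -> e \in closure M' X ->
          e |: F \subset closure M' X].

Section Trees.
Variables (V : finType) (adj : rel V).

Definition degree (v : V) : nat := #|[set w | adj v w]|.

Definition leaves : {set V} := [set v | degree v == 1].

(* Acyclicity is [size c <= 2]: in a symmetric relation each edge xy gives
   [ucycle adj [:: x; y]], which is not a cycle of the graph. *)
Definition is_tree : Prop :=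
  [/\ 0 < #|V|, symmetric adj, irreflexive adj,
      forall x y, connect adj x y &
      forall c : seq V, ucycle adj c -> size c <= 2].

Definition subcubic_tree : Prop :=
  is_tree /\ forall v, degree v = 3 \/ degree v = 1.

Definition delete_edge (u v : V) : rel V :=
  fun x y => adj x y && ([set x; y] != [set u; v]).

End Trees.

(* The values of [dec_leaf] outside [ground M] are irrelevant. *)
Record decomposition (T : finType) (M : matroid T) := Decomposition {
  dec_vertex : finType;
  dec_adj : rel dec_vertex;
  dec_leaf : T -> dec_vertex;
  dec_subcubic : subcubic_tree dec_adj;
  dec_leaf_inj : {in ground M &, injective dec_leaf};
  dec_leaf_onto : dec_leaf @: ground M = leaves dec_adj }.

Section Widths.
Variables (T : finType) (M : matroid T).

Definition edge_side (D : decomposition M) (u v : dec_vertex D) : {set T} :=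
  [set x in ground M | connect (delete_edge (@dec_adj _ _ D) u v) u (dec_leaf D x)].

(* Each edge uv is visited as (u, v) and as (v, u), giving both of its sides. *)
Definition displayed (D : decomposition M) : {set {set T}} :=
  [set edge_side p.1 p.2 |
     p in [pred p : dec_vertex D * dec_vertex D | dec_adj p.1 p.2]].

End Widths.

(* The least value of [f], with the convention that it is 0 if [A] is empty. *)
Definition min_over (A : Type) (f : A -> nat) : nat :=
  if pselect (exists n, `[< exists a, f a = n >]) is left h
  then ex_minn h else 0.

(* A matroid with fewer than two elements has no decomposition, as a tree whose
   vertices all have degree one or three has at least two leaves; both widths of
   such a matroid are therefore 0. *)
Definition branch_width (T : finType) (M : matroid T) : nat :=
  min_over (fun D : decomposition M => \max_(U in displayed D) (lambda M U).+1).

Definition decomposition_width (T : finType) (M : matroid T) : nat :=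
  min_over (fun D : decomposition M =>
    \max_(U in displayed D) sim_classes M U).

(* No closure under isomorphism is assumed. *)
Definition matroid_class := forall T : finType, matroid T -> Prop.

Definition contains_uniform (r : nat) (C : matroid_class) : Prop :=
  forall (T : finType) (M : matroid T), uniform M r -> C T M.

Definition closed_under_principal_extensions (C : matroid_class) : Prop :=
  forall (T : finType) (M M' : matroid T),
    C T M -> principal_extension M M' -> C T M'.

Definition pigeonhole (C : matroid_class) : Prop :=
  forall lam : nat, 0 < lam -> exists rho : nat,
    forall (T : finType) (M : matroid T), C T M ->
      branch_width M <= lam -> decomposition_width M <= rho.

(* Main.v *)
From mathcomp Require Import all_boot zify.
From mathcomp Require Import boolp.
Require Import Defs.
Set Implicit Arguments.
Unset Strict Implicit.
Unset Printing Implicit Defensive.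

(** Let M_n be the rank-3 matroid whose points are the vertices and the edges of
the complete graph on n vertices, and whose only lines with more than two points
are the sets {i, j, ij}.  It arises from the uniform matroid of rank 3 on the
vertices by placing each edge ij freely on the line spanned by i and j, which is
a principal extension relative to the flat {i, j}; so M_n lies in the class
([line_matroid_extension], [graph_matroid_in_class]).  Its rank is 3, so its
branch-width is bounded independently of n, and the point is that its
decomposition-width is not.

Call a point x of U tangent when the two other points of some 3-point line
through x lie outside U.  Those two points form a set Z that completes {x} to a
dependent set, but completes no other singleton of U to one, because two points
determine their line.  Hence U has at least as many classes as tangent points
([tangent_points_classes]).

Every decomposition displays an edge both of whose sides U and W contain at least
a third of the points ([balanced_edge]).  Suppose that both sides have at most
rho classes, and that U contains at least as many vertices as W.
- At most rho vertices lie in W.  Otherwise some vertex j of W is not tangent,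
  so that for each vertex i of U the edge ij lies in W; then {i, j, ij} meets U
  in i only, and all vertices of U, which are more than rho, are tangent.
- An edge of W joining two vertices of U is tangent, so there are at most rho of
  these; the other points of W are vertices of W or edges at a vertex of W.
So W has at most rho + n * rho points ([light_side_small]), whereas a third of
all the points is at least n ^ 2 / 6, which is larger for n = 6 * (rho + 1).

Since widths are 0 when there is no decomposition, it must also be shown that
one exists ([decomposition_exists]). *)

(** * Rank-3 matroids defined by lines *)

Section Rank.
Variables (T : finType) (M : matroid T).
Implicit Types (I X : {set T}).

Lemma rank_ge I X : I \in indep M -> I \subset X -> #|I| <= rank M X.
Proof.
move=> iI IX.
apply: (@leq_bigmax_cond _ [pred J | (J \in indep M) && (J \subset X)]
  (fun J => #|J|)); exact/andP.
Qed.

Lemma rank_le m X :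
  (forall I, I \in indep M -> I \subset X -> #|I| <= m) -> rank M X <= m.
Proof. by move=> h; apply/bigmax_leqP => I /andP [iI IX]; apply: h. Qed.

Lemma rank_basis X : exists I, [/\ I \in indep M, I \subset X & #|I| = rank M X].
Proof.
have [|I] := @eq_bigmax_cond _ [pred I | (I \in indep M) && (I \subset X)] (fun I => #|I|).
  by apply/card_gt0P; exists set0; rewrite inE /= indep_set0 sub0set.
by move=> /andP [iI IX] E; exists I; rewrite /rank E.
Qed.

Lemma rankS X (Y : {set T}) : X \subset Y -> rank M X <= rank M Y.
Proof.
by move=> XY; apply: rank_le => I iI IX; apply: rank_ge iI (subset_trans IX XY).
Qed.

Lemma mem_closure X x : x \in ground M -> x \in X -> x \in closure M X.
Proof. by move=> xE xX; rewrite inE xE (setUidPr _) ?sub1set ?eqxx. Qed.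

End Rank.

Section Lines.
Variable T : finType.
Implicit Types (E X l : {set T}) (L : {set {set T}}).

(** A linear space, given by its three-point lines; all other lines have two points
and are left implicit. *)
Definition linear_space E L : Prop :=
  (forall l, l \in L -> l \subset E /\ #|l| = 3) /\
  (forall l l', l \in L -> l' \in L -> 1 < #|l :&: l'| -> l = l').

(** The simple rank-3 matroid of the points of a plane in which the members of [L]
are the only collinear triples.  It is a predicate rather than a construction so
that the same matroid can be described by different expressions for [E] and [L]. *)
Definition line_matroid (M : matroid T) E L : Prop :=
  ground M = E /\
  forall X, (X \in indep M) = [&& X \subset E, #|X| <= 3 & X \notin L].

(** Only augmentation of a pair by a triple is not immediate: if two distinct points
of the triple each completed the pair [X] to a line, these lines would share [X]. *)
Lemma line_matroid_exists E L : linear_space E L -> exists M, line_matroid M E L.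
Proof.
move=> [L3 Lmeet].
pose P := [set X : {set T} | [&& X \subset E, #|X| <= 3 & X \notin L]].
have NL X : #|X| < 3 -> X \notin L by apply: contraTN => /L3 [_ ->].
have h1 X : X \in P -> X \subset E by rewrite inE => /and3P [].
have h2 : set0 \in P by rewrite inE sub0set cards0 NL ?cards0.
have h3 X (Y : {set T}) : X \subset Y -> Y \in P -> X \in P.
  move=> XY; rewrite !inE => /and3P [YE Y3 YL].
  rewrite (subset_trans XY YE) (leq_trans (subset_leq_card XY) Y3) /=.
  have [->//|nXY] := eqVneq X Y; apply: NL.
  apply: leq_trans Y3; apply: proper_card; by rewrite properEneq nXY.
have h4 X (Y : {set T}) : X \in P -> Y \in P -> #|X| < #|Y| ->
    exists2 y, y \in Y :\: X & y |: X \in P.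
  rewrite !inE => /and3P [XE X3 XL] /and3P [YE Y3 YL] XY.
  have sub y : y \in Y -> y |: X \subset E.
    by move=> yY; rewrite subUset sub1set XE (subsetP YE).
  have YX : 0 < #|Y :\: X|.
    by have := cardsID X Y; have := subset_leq_card (subsetIr Y X); lia.
  have [X1|X2] := ltnP #|X| 2.
    case/card_gt0P: YX => y yYX; exists y => //; move: yYX; rewrite !inE => /andP [yX yY].
    by rewrite sub // NL ?cardsU1 yX; lia.
  have cX : #|X| = 2 by lia.
  have cY : #|Y| = 3 by lia.
  have card3 y : y \notin X -> #|y |: X| = 3 by move=> yX; rewrite cardsU1 yX cX.
  have [XsY|nXsY] := boolP (X \subset Y).
    case/card_gt0P: YX => y yYX; exists y => //; move: yYX; rewrite !inE => /andP [yX yY].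
    rewrite sub // card3 //=; suff -> : y |: X = Y by [].
    by apply/eqP; rewrite eqEcard subUset sub1set yY XsY card3 // cY.
  have : 1 < #|Y :\: X|.
    have := cardsID X Y.
    have : Y :&: X \proper X.
      by rewrite properEneq subsetIr andbT; apply: contraNneq nXsY => <-; rewrite subsetIl.
    by move/proper_card; lia.
  case/card_gt1P => y [z []]; rewrite !inE => /andP [yX yY] /andP [zX zY] yz.
  have [yL|yL] := boolP (y |: X \in L); last first.
    by exists y; rewrite !inE ?yX // sub // card3.
  have [zL|zL] := boolP (z |: X \in L); last first.
    by exists z; rewrite !inE ?zX // sub // card3.
  have E1 : y |: X = z |: X.
    apply: Lmeet => //; rewrite -cX; apply: subset_leq_card.
    by rewrite subsetI !subsetU1.
  by have := setU11 y X; rewrite E1 !inE (negbTE yz) (negbTE yX).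
exists (Matroid h1 h2 h3 h4); split => // X; by rewrite inE.
Qed.

Lemma line_matroid_rank_le3 M E L X : line_matroid M E L -> rank M X <= 3.
Proof. by move=> [_ iM]; apply: rank_le => I; rewrite iM => /and3P []. Qed.

Lemma line_matroid_small M E L X : linear_space E L -> line_matroid M E L ->
  X \subset E -> #|X| <= 2 -> X \in indep M.
Proof.
move=> [L3 _] [_ ->] -> X2; rewrite (leq_trans X2) //=.
by apply: contraTN X2 => /L3 [_ ->].
Qed.

(** The new point [e] is placed on the line spanned by [a] and [b].  A set of old
points that spans [e] either has full rank or contains a basis that [e] completes
to a line; the only line through [e] is [{a, b, e}], so that basis is [{a, b}]. *)
Lemma line_matroid_extension M M' E L a b e :
    linear_space E L -> line_matroid M E L ->
    linear_space (e |: E) ([set a; b; e] |: L) ->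
    line_matroid M' (e |: E) ([set a; b; e] |: L) ->
    a \in E -> b \in E -> a != b -> e \notin E ->
    principal_extension M M'.
Proof.
move=> sL mM sL' mM' aE bE ab eE; set F := [set a; b]; set l := [set a; b; e].
have [gM iM] := mM; have [gM' iM'] := mM'.
have [L3 Lmeet] := sL; have [L3' Lmeet'] := sL'.
have cF : #|F| = 2 by rewrite cards2 ab.
have FE : F \subset E by rewrite subUset !sub1set aE.
have Fl : F \subset l by apply: subsetUl.
have le : e |: F = l by rewrite setUC.
have lL : l \notin L.
  by apply: contra eE => /L3 [/subsetP + _]; apply; rewrite /l !inE eqxx orbT.
have FL m : m \in l |: L -> F \subset m -> m = l.
  move=> mL Fm; apply: Lmeet' => //; first by rewrite setU11.
  by rewrite -cF subset_leq_card // subsetI Fm.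
have FM : F \in indep M by apply: (line_matroid_small sL mM) => //; rewrite cF.
have FM' : F \in indep M'.
  by apply: (line_matroid_small sL' mM'); rewrite ?cF // (subset_trans FE) ?subsetU1.
(* Points off the new line are independent of [a] and [b]: this makes both flats. *)
have F3 x : x \in e |: E -> x \notin l -> x |: F \in indep M'.
  move=> xE xl; rewrite iM' subUset sub1set xE (subset_trans FE) ?subsetU1 //=.
  rewrite cardsU1 cF (leq_trans (leq_add (leq_b1 _) (leqnn 2))) //=.
  by apply: contraNN xl => /FL /(_ (subsetUr _ _)) <-; rewrite setU11.
have iMM' X : X \subset E -> (X \in indep M') = (X \in indep M).
  move=> XE; rewrite iM iM' XE (subset_trans XE) ?subsetU1 //= in_setU1.
  case: eqP => // XF; case/negP: eE; rewrite (subsetP XE) // XF /l.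
  by rewrite !inE eqxx orbT.
have rF (N : matroid T) : F \in indep N -> rank N F = 2.
  move=> FN; apply/eqP; rewrite eqn_leq -{2}cF rank_ge // andbT.
  by rewrite -cF; apply: rank_le => I _ /subset_leq_card.
have rl : rank M' l = 2.
  apply/eqP; rewrite eqn_leq -{2}cF rank_ge // andbT; apply: rank_le => I.
  rewrite iM' => /and3P [_ I3 IL] Il; rewrite -ltnS ltn_neqAle I3 andbT.
  apply: contraNneq IL => cI; suff -> : I = l by rewrite setU11.
  by apply/eqP; rewrite eqEcard Il cI; have [_ ->] := L3' l (setU11 _ _).
exists F, e; split.
- split; first by rewrite gM.
  apply/setP=> x; apply/idP/idP => [|xF]; last first.
    by rewrite mem_closure // gM (subsetP FE).
  rewrite inE gM => /andP [xE]; rewrite rF //; apply: contraTT => xF.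
  have xl : x \notin l by rewrite in_setU in_set1 negb_or xF; apply: contraNneq eE => <-.
  have := F3 _ (setU1r _ xE) xl; rewrite iMM' ?subUset ?sub1set ?xE ?aE ?bE // => xFM.
  have := rank_ge xFM (subxx _); by rewrite cardsU1 xF cF; case: eqP => // ->.
- by split; rewrite ?gM.
- by rewrite inE gM' setU11 le rl rF.
- rewrite le; split; first by rewrite gM'; have [] := L3' l (setU11 _ _).
  apply/setP=> x; apply/idP/idP => [|xF]; last first.
    by rewrite mem_closure // gM'; have [/subsetP + _] := L3' l (setU11 _ _); apply.
  rewrite inE gM' => /andP [xE]; rewrite rl; apply: contraTT => xF.
  have := rank_ge (F3 _ xE xF) (setUS [set x] Fl).
  rewrite cardsU1 cF; have -> : x \notin F by apply: contraNN xF; apply: (subsetP Fl).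
  by case: eqP => // ->.
- move=> X; rewrite gM => XE; rewrite inE => /andP [_ /eqP er].
  have [I [iI IX cI]] := rank_basis M' X.
  have [r3|r2] := leqP 3 #|I|.
    apply/subsetP => x; rewrite le => xl.
    have [/subsetP lE _] := L3' l (setU11 _ _).
    rewrite inE gM' lE //= eqn_leq (rankS _ (subsetUr [set x] X)) andbT -cI (leq_trans _ r3) //.
    exact: line_matroid_rank_le3 mM'.
  have IE : I \subset E := subset_trans IX XE.
  have eI : e \notin I by apply: contraNN eE; apply: (subsetP IE).
  suff FX : F \subset X.
    apply/subsetP=> x; rewrite in_setU1 => /orP [/eqP->|xF].
      by rewrite inE gM' setU11 er eqxx.
    by rewrite mem_closure ?gM' ?(subsetP FX) // in_setU1 (subsetP FE) ?orbT.
  have: e |: I \notin indep M'.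
    apply/negP => /rank_ge /(_ (setUS [set e] IX)).
    by rewrite er -cI cardsU1 eI add1n ltnn.
  rewrite iM' subUset sub1set setU11 (subset_trans IE) ?subsetU1 //=.
  rewrite cardsU1 eI add1n r2 /= negbK in_setU1 => /orP [/eqP El|]; last first.
    by move/L3 => [/subsetP /(_ e (setU11 _ _))]; rewrite (negbTE eE).
  apply: subset_trans IX; apply/subsetP => x xF.
  have : x \in e |: I by rewrite El (subsetP Fl).
  by rewrite in_setU1 => /orP [/eqP xe|//]; case/negP: eE; rewrite -xe (subsetP FE).
Qed.

End Lines.

(** * A balanced edge of a decomposition *)

Lemma connect_closed_ind (V : finType) (e : rel V) (Q : pred V) x y :
  Q x -> (forall a b, Q a -> e a b -> Q b) -> connect e x y -> Q y.
Proof.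
move=> Qx step /connectP [p + ->]; elim: p x Qx => //= a p IH x Qx /andP [xa].
exact: IH (step _ _ Qx xa).
Qed.

Section TreeSides.
Variables (V : finType) (adj : rel V).
Hypothesis tree : is_tree adj.
Implicit Types u v w x y : V.

Definition side u v : {set V} := [set x | connect (delete_edge adj u v) v x].

Lemma delete_edgeC u v : delete_edge adj u v =2 delete_edge adj v u.
Proof. by move=> x y; rewrite /delete_edge [[set u; v]]setUC. Qed.

Lemma delete_edgeN u v x y : adj x y -> x != v -> y != v -> delete_edge adj u v x y.
Proof.
move=> xy xv yv; rewrite /delete_edge xy; apply: contraNneq xv => E.
by have := set22 u v; rewrite -E !inE eq_sym [v == y]eq_sym (negbTE yv) orbF.
Qed.

Lemma side_root u v : v \in side u v.
Proof. by rewrite inE connect0. Qed.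

Lemma sideU u v : side u v :|: side v u = setT.
Proof.
have [_ _ _ conn _] := tree.
apply/setP=> y; rewrite in_setT.
apply: (connect_closed_ind (Q := [in side u v :|: side v u])) (conn v y).
  by rewrite !inE connect0.
move=> a b; rewrite !inE => ab eab.
have [|nE] := eqVneq [set a; b] [set u; v].
  move=> E; have := set22 a b; rewrite E !inE => /orP [] /eqP ->;
  by rewrite connect0 ?orbT.
apply/orP; case/orP: ab => ab; [left|right]; apply: connect_trans ab (connect1 _).
  by rewrite /delete_edge eab.
by rewrite delete_edgeC /delete_edge eab.
Qed.

(** A path from [v] back to [u] avoiding the edge [uv] would close up to a cycle. *)
Lemma side_disjoint u v : adj u v -> u \notin side u v.
Proof.
have [_ _ irr _ acyc] := tree.
move=> uv; rewrite inE; apply/negP => /connectP [p0].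
case/shortenP=> p pth un _ lst.
have : size (v :: p) <= 2.
  apply: acyc; rewrite /ucycle un /= rcons_path -lst uv !andbT.
  by apply: sub_path pth => a b /andP [].
case: p pth un lst => [|a [|//]] /=.
  by move=> _ _ E _; rewrite E irr in uv.
by rewrite andbT => + _ E _; rewrite -E /delete_edge setUC eqxx andbF.
Qed.

Lemma sideI u v x : adj u v -> x \in side u v -> x \notin side v u.
Proof.
move=> uv xu; apply: contra (side_disjoint uv); move: xu; rewrite !inE.
rewrite (eq_connect (delete_edgeC v u)) => vx ux; apply: connect_trans vx _.
have [_ symm _ _ _] := tree; rewrite sym_connect_sym // => a b.
by rewrite /delete_edge symm setUC.
Qed.

(** The next vertex [w] on a simple path from [v] to [x]: the rest of that path avoids
[v], hence the edge [vw]. *)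
Lemma side_split u v x : x \in side u v -> x != v ->
  exists2 w, adj v w && (w != u) & x \in side v w.
Proof.
rewrite inE => /connectP [p0]; case/shortenP=> p + + _ ->.
case: p => [|w p] /=; first by rewrite eqxx.
case/andP=> /andP [vw nE] pth /andP [vp un] _; exists w.
  by rewrite vw; apply: contraNneq nE => ->; rewrite setUC.
rewrite inE; apply/connectP; exists p => //.
move: vp pth; rewrite inE negb_or => /andP [].
elim: p w {un vw nE} => //= a p IH w vw.
rewrite inE negb_or => /andP [va vp] /andP [/andP [wa _] pth].
apply/andP; split.
  by rewrite delete_edgeC; apply: delete_edgeN; rewrite // eq_sym.
have := IH a va vp pth; apply: (@sub_in_path _ (predC1 v)) => /=; last first.
  by rewrite eq_sym va; apply/allP => y yp; apply: contraNneq vp => <-.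
move=> b c; rewrite !inE => bv cv /andP [bc _].
by rewrite delete_edgeC; apply: delete_edgeN.
Qed.

Lemma side_proper u v w : adj u v -> adj v w -> w != u -> side v w \proper side u v.
Proof.
move=> uv vw wu; have vS := side_disjoint vw.
have [_ symm irr _ _] := tree.
apply/properP; split; last by exists v => //; exact: side_root.
apply/subsetP => y; rewrite inE => cy.
suff /andP [] : (y \in side v w) && (y \in side u v) by [].
move: cy; apply: (connect_closed_ind (Q := fun y => (y \in side v w) && (y \in side u v))).
  rewrite side_root inE connect1 // /delete_edge vw.
  apply: contraNneq wu => E; have := set22 v w; rewrite E !inE => /orP [//|/eqP wv].
  by rewrite wv irr in vw.
move=> a b /andP [aw au] ab.
have bw : b \in side v w by move: aw; rewrite !inE => /connect_trans; apply; exact: connect1.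
rewrite bw; move: au; rewrite !inE => /connect_trans; apply; apply: connect1.
case/andP: ab => ab _; apply: delete_edgeN => //.
  by apply/eqP => av; rewrite -{1}av aw in vS.
by apply/eqP => bv; rewrite -{1}bv bw in vS.
Qed.

End TreeSides.

Section Balanced.
Variables (T : finType) (M : matroid T) (D : decomposition M).
Local Notation adj := (@dec_adj _ _ D).
Local Notation leaf := (@dec_leaf _ _ D).

Lemma mem_edge_side u v x :
  (x \in edge_side (D := D) u v) = (x \in ground M) && (leaf x \in side adj v u).
Proof. by rewrite !inE (eq_connect (delete_edgeC _ _ _)). Qed.

Lemma edge_sideC u v : adj u v ->
  edge_side (D := D) v u = ground M :\: edge_side (D := D) u v.
Proof.
have [tree _] := dec_subcubic D.
move=> uv; apply/setP=> x; rewrite in_setD !mem_edge_side.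
case: (x \in ground M); rewrite ?andbF //= andbT.
have := in_setT (leaf x); rewrite -(sideU tree u v) in_setU.
case: (boolP (leaf x \in side adj u v)) => [xS _|_ /= ->//].
by rewrite (sideI tree uv xS).
Qed.

(** If [v] is a leaf, it carries at most one element; otherwise it carries none, and
its side splits along the two edges at [v] other than [uv]. *)
Lemma edge_side_split u v : adj v u ->
  (#|edge_side (D := D) v u| <= 1) \/
  exists w w', [/\ adj v w && (w != u), adj v w' && (w' != u) &
    #|edge_side (D := D) v u| <= #|edge_side (D := D) w v| + #|edge_side (D := D) w' v|].
Proof.
have [tree deg] := dec_subcubic D => vu.
have [d3|d1] := deg v; [right|left].
  have /cards2P [w [w' [ww' E]]] : #|[set w | adj v w] :\ u| == 2.
    by have := cardsD1 u [set w | adj v w]; rewrite inE vu -/(degree adj v) d3 /=; lia.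
  have mem z : (adj v z && (z != u)) = (z \in [set w; w']) by rewrite -E !inE andbC.
  exists w, w'; rewrite !mem set21 set22; split=> //.
  apply: leq_trans (leq_card_setU _ _); apply/subset_leq_card/subsetP => x.
  rewrite in_setU !mem_edge_side => /andP [xM xS]; rewrite xM /=.
  have xv : leaf x != v.
    apply: contraTneq (imset_f leaf xM) => ->.
    by rewrite dec_leaf_onto inE d3.
  have [z] := side_split xS xv; rewrite mem !inE => /orP [] /eqP -> ->//.
  by rewrite orbT.
apply/card_le1_eqP => x y; rewrite !mem_edge_side => /andP [xM xS] /andP [yM yS].
have onlyu z : adj v z -> z = u.
  have /cards1P [w E] : #|[set w | adj v w]| == 1 by rewrite -/(degree adj v) d1.
  have mem t : adj v t = (t == w) by have := in_set1 t w; rewrite -E inE.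
  by move: vu; rewrite !mem => /eqP -> /eqP ->.
have leafv z : leaf z \in side adj u v -> leaf z = v.
  move=> zS; apply/eqP/negPn/negP => /(side_split zS) [w].
  by case/andP => /onlyu ->; rewrite eqxx.
by apply: (@dec_leaf_inj _ _ D) => //; rewrite (leafv x xS) (leafv y yS).
Qed.

(** Among the oriented edges whose head side has more than a third of the elements,
take one with the smallest head side.  The branches beyond its head are not heavy, so
the head side has at most two thirds of the elements. *)
Lemma balanced_edge : 1 < #|ground M| -> exists u v, [/\ adj u v,
  #|ground M| <= 3 * #|edge_side (D := D) u v| &
  #|ground M| <= 3 * #|edge_side (D := D) v u| ].
Proof.
have [tree deg] := dec_subcubic D; have [V0 symm irr _ _] := tree => N1.
pose heavy u v := adj u v && (#|ground M| < 3 * #|edge_side (D := D) v u|).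
have cardD u v : adj u v ->
    #|edge_side (D := D) u v| + #|edge_side (D := D) v u| = #|ground M|.
  move=> uv; rewrite (edge_sideC uv) -(cardsID (edge_side (D := D) u v) (ground M)).
  congr (#|pred_of_set _| + _); apply/esym/setIidPr.
  by apply/subsetP => x; rewrite inE => /andP [].
have [u0 [v0 h0]] : exists u v, heavy u v.
  case/card_gt0P: V0 => v _.
  have /card_gt0P [w] : 0 < #|[set w | adj v w]|.
    by rewrite -/(degree adj v); case: (deg v) => ->.
  rewrite inE => vw; have wv : adj w v by rewrite symm.
  have := cardD _ _ vw => E.
  have [h|h] := leqP #|edge_side (D := D) v w| #|edge_side (D := D) w v|.
    by exists v, w; rewrite /heavy vw; lia.
  by exists w, v; rewrite /heavy wv; lia.
pose p := [arg min_(p < (u0, v0) | heavy p.1 p.2) #|side adj p.1 p.2|].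
have [] : heavy p.1 p.2 /\
    forall q, heavy q.1 q.2 -> #|side adj p.1 p.2| <= #|side adj q.1 q.2|.
  by rewrite /p; case: arg_minnP.
case: p => u v /= /andP [uv huv] minp; exists u, v; split => //; last lia.
have vu : adj v u by rewrite symm.
have light w : adj v w && (w != u) -> 3 * #|edge_side (D := D) w v| <= #|ground M|.
  move=> /andP [vw wu]; rewrite leqNgt; apply/negP => h.
  have /minp /= : heavy (v, w).1 (v, w).2 by rewrite /heavy /= vw.
  by rewrite leqNgt (proper_card (side_proper tree uv vw wu)).
have := cardD _ _ uv.
have [h|[w [w' [/light lw /light lw' h]]]] := edge_side_split vu; lia.
Qed.

End Balanced.

(** * Existence of a decomposition *)

Section ParentTree.
Variables (m : nat) (p : nat -> nat).
Hypothesis p0 : p 0 = 0.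
Hypothesis p_lt : forall x, 0 < x -> p x < x.

Definition parent_adj : rel 'I_m.+1 :=
  fun x y => (x != y) && ((p x == y) || (p y == x)).

(** A graph in which each number is joined to its parent, a smaller number, is a
tree: the largest vertex of a cycle would have two distinct smaller neighbours, both
equal to its parent. *)
Lemma parent_adj_tree : is_tree parent_adj.
Proof.
have symm : symmetric parent_adj by move=> x y; rewrite /parent_adj eq_sym orbC.
have adj_lt x y : parent_adj x y -> y <= x -> p x = y :> nat.
  rewrite /parent_adj -val_eqE /= => /andP [xy /orP [/eqP //|/eqP pyx]] yx.
  have := @p_lt y; case: (posnP y) => [y0|y0 /(_ isT)]; last lia.
  by move: pyx; rewrite y0 p0; lia.
split=> //.
- by rewrite card_ord.
- by move=> x; rewrite /parent_adj eqxx.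
- suff to0 x : connect parent_adj x ord0.
    by move=> x y; apply: connect_trans (to0 x) _; rewrite sym_connect_sym.
  case: x => x; elim/ltn_ind: x => x IH xm.
  have [x0|x0] := posnP x; first by apply: eq_connect0; apply: val_inj.
  have pm : p x < m.+1 := ltn_trans (p_lt x0) xm.
  apply: connect_trans (IH (p x) (p_lt x0) pm); apply: connect1.
  by rewrite /parent_adj -val_eqE /= eqxx gtn_eqF // p_lt.
- move=> c /andP [cyc un]; rewrite leqNgt; apply/negP => c3.
  have [x0 x0c] : exists x, x \in c.
    by case: c c3 {cyc un} => // x c; exists x; rewrite mem_head.
  have [x xc maxx] := @arg_maxnP _ x0 [in c] (fun x : 'I_m.+1 => x : nat) x0c.
  case: (rot_to xc) => i c' E.
  have maxc y : y \in c' -> y <= x.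
    by move=> yc'; apply: maxx; rewrite /= -(mem_rot i) E inE yc' orbT.
  move: cyc un c3; rewrite -(rot_cycle i) -(rot_uniq i) -(size_rot i) E.
  case: c' maxc {E} => [|y c'] //; case/lastP: c' => [|c' z] // maxc.
  rewrite -rcons_cons /cycle rcons_path /= last_rcons => /andP [/andP [xy _] zx].
  rewrite mem_rcons inE negb_or => /andP [_ /andP [/andP [yz _] _]] _.
  case/negP: yz; rewrite -val_eqE /= -(adj_lt _ _ xy) ?maxc ?mem_head //.
  by rewrite symm in zx; rewrite (adj_lt _ _ zx) // maxc // inE mem_rcons mem_head orbT.
Qed.

End ParentTree.

Section Caterpillar.
Variable k : nat.
Local Notation m := k.*2.+1.
(** Starting from the edge 01, the vertices [2j+2] and [2j+3] are attached to [2j+1],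
for each [j < k].  The leaves are the even vertices and the last one. *)
Let p x := (x./2).*2.-1.
Local Notation V := 'I_m.+1.
Local Notation adj := (parent_adj p : rel V).

Lemma caterpillar_degree (x : V) : degree adj x = if ~~ odd x || (x == m :> nat) then 1 else 3.
Proof.
have nb (w : V) : adj x w = (x != w) && ((p x == w) || (p w == x)) by [].
rewrite /degree; have [x0|x0] := posnP x.
  rewrite x0 /=; have -> : [set w | adj x w] = [set inord 1]; last by rewrite cards1.
  apply/setP => w; rewrite !inE nb -!val_eqE /= inordK // x0 /p.
  lia.
have xm := ltn_ord x.
have px : p x < k.*2.+2 by (rewrite /p; lia).
case: ifP => h.
  have -> : [set w | adj x w] = [set inord (p x)]; last by rewrite cards1.
  apply/setP => w; rewrite !inE nb -!val_eqE /= inordK //.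
  have := ltn_ord w; rewrite {nb} /p in px *; lia.
have -> : [set w | adj x w] = [set inord (p x); inord x.+1; inord x.+2].
  apply/setP => w; rewrite !inE nb -!val_eqE /= !inordK; rewrite /p ; lia.
rewrite setUC cardsU1 cards2 !inE -!val_eqE /= !inordK; rewrite /p; lia.
Qed.

Lemma caterpillar_leaves : #|leaves adj| = k.+2.
Proof.
pose f (i : 'I_k.+2) : V := inord (if i < k.+1 then i.*2 else m).
have fE i : f i = (if i < k.+1 then i.*2 else m) :> nat.
  by rewrite inordK //; case: ifP; lia.
have -> : leaves adj = f @: setT.
  apply/setP => x; rewrite inE caterpillar_degree; apply/idP/imsetP.
    have [xm _|xm xodd] := eqVneq (x : nat) m.
      by exists ord_max => //; apply: val_inj; rewrite /= fE ltnn.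
    have xm' := ltn_ord x.
    exists (inord x./2) => //; apply: val_inj; rewrite /= fE inordK; last lia.
    by move: xodd; case: ifP => //; case: ifP; lia.
  by move=> [i _ ->]; rewrite fE; case: (ifP (i < _)); rewrite ?odd_double ?eqxx ?orbT.
rewrite card_imset ?cardsT ?card_ord // => i j /(congr1 val) /=; rewrite !fE => E.
apply: ord_inj; have := ltn_ord i; have := ltn_ord j; move: E.
by case: ifP; case: ifP; lia.
Qed.

Lemma caterpillar_subcubic : subcubic_tree adj.
Proof.
split=> [|v]; last by rewrite caterpillar_degree; case: ifP; [right|left].
by apply: parent_adj_tree => // x x0; rewrite /p; lia.
Qed.

End Caterpillar.

Lemma decomposition_exists (T : finType) (M : matroid T) :
  1 < #|ground M| -> exists D : decomposition M, True.
Proof.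
case E : #|ground M| => [|[|k]] // _.
set adj : rel 'I_k.*2.+2 := parent_adj (fun x => (x./2).*2.-1).
have cL : #|leaves adj| = #|ground M| by rewrite caterpillar_leaves E.
pose leaf x := nth ord0 (enum (leaves adj)) (index x (enum (ground M))).
have szE : size (enum (leaves adj)) = size (enum (ground M)) by rewrite -!cardE.
have leaf_in x : x \in ground M -> index x (enum (ground M)) < size (enum (leaves adj)).
  by rewrite szE index_mem mem_enum.
have inj : {in ground M &, injective leaf}.
  move=> x y xM yM /eqP; rewrite nth_uniq ?leaf_in ?enum_uniq // => /eqP.
  by move/(congr1 (nth x (enum (ground M)))); rewrite !nth_index ?mem_enum.
suff onto : leaf @: ground M = leaves adj.
  by exists (Decomposition (caterpillar_subcubic k) inj onto).
apply/eqP; rewrite eqEcard card_in_imset // cL leqnn andbT.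
by apply/subsetP => _ /imsetP [x xM ->]; rewrite -mem_enum mem_nth ?leaf_in.
Qed.

(** * Tangent points and equivalence classes *)

Section Classes.
Variables (T : finType) (M : matroid T).

Lemma sim_classes_ge (U : {set T}) (A : {set {set T}}) :
  A \subset powerset U -> {in A &, forall X X', sim M U X X' -> X = X'} ->
  #|A| <= sim_classes M U.
Proof.
move=> AU injA; pose f X := [set Y in powerset U | sim M U X Y].
have injf : {in A &, injective f}.
  move=> X X' XA X'A /setP /(_ X); rewrite !inE -powersetE (subsetP AU) //=.
  have -> : sim M U X X by apply/forall_inP.
  by move/esym/(injA _ _ X'A XA).
rewrite -(card_in_imset injf); apply: subset_leq_card.
by apply/subsetP => _ /imsetP [X XA ->]; apply: imset_f; apply: (subsetP AU).
Qed.

Lemma branch_width_le m : (forall U, lambda M U < m) -> branch_width M <= m.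
Proof.
rewrite /branch_width /min_over => h; case: pselect => // ex.
by case: ex_minnP => k /asboolP [D <-] _; apply/bigmax_leqP.
Qed.

Lemma decomposition_width_attained m : 1 < #|ground M| -> decomposition_width M <= m ->
  exists D : decomposition M, forall U, U \in displayed D -> sim_classes M U <= m.
Proof.
move=> /decomposition_exists [D0 _]; rewrite /decomposition_width /min_over.
case: pselect => [ex|[]]; last by eexists; apply/asboolP; exists D0.
by case: ex_minnP => k /asboolP [D <-] _ /bigmax_leqP h; exists D.
Qed.

Definition tangent_points (L : {set {set T}}) (U W : {set T}) : {set T} :=
  [set x in U | [exists l in L, (x \in l) && (l :\ x \subset W)]].

(** The tangent line of [x] minus [x] distinguishes the singleton [{x}] from all other
singletons of [U], as two points lie on only one line. *)
Lemma tangent_points_classes E L (U : {set T}) : linear_space E L -> line_matroid M E L ->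
  U \subset E -> #|tangent_points L U (E :\: U)| <= sim_classes M U.
Proof.
move=> [L3 Lmeet] [gM iM] UE; rewrite -(card_imset _ set1_inj).
apply: sim_classes_ge.
  apply/subsetP => _ /imsetP [x + ->]; rewrite inE => /andP [xU _].
  by rewrite powersetE sub1set.
move=> _ _ /imsetP [x + ->] /imsetP [y + ->]; rewrite !inE.
case/andP=> xU /exists_inP [l lL /andP [xl lx]] /andP [yU _] /forall_inP.
have [lE l3] := L3 l lL.
move=> /(_ (l :\ x)); rewrite gM => /(_ lx); rewrite (setD1K xl) !iM lL !andbF.
have lxE : l :\ x \subset E := subset_trans lx (subsetDl _ _).
have c2 : #|l :\ x| = 2 by have := cardsD1 x l; rewrite xl l3; lia.
have yl : y \notin l :\ x.
  by apply/negP => /(subsetP lx); rewrite inE yU.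
rewrite subUset sub1set (subsetP UE y yU) lxE cardsU1 yl c2 /= eq_sym eqbF_neg negbK => yL.
have E1 : y |: l :\ x = l.
  by apply: Lmeet => //; rewrite -c2 subset_leq_card // subsetI subsetUr subD1set.
have: y \in l by rewrite -E1 setU11.
by move: yl; rewrite !inE; case: eqVneq => [->|_ /= /negP].
Qed.

End Classes.

(** * The matroid of a complete graph *)

Section CompleteGraph.
Variable n : nat.
Implicit Types (e x : {set 'I_n}) (S : {set {set 'I_n}}).

(** A vertex is encoded as a singleton and an edge as a 2-set, so that both live in
one type and the vertices of an edge are the singletons of its members. *)
Definition vertices : {set {set 'I_n}} := [set x : {set 'I_n} | #|x| == 1].
Definition edges : {set {set 'I_n}} := [set x : {set 'I_n} | #|x| == 2].
Definition edge_line e : {set {set 'I_n}} := e |: [set [set i] | i in e].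

Lemma edge_lineE i j : edge_line [set i; j] = [set [set i]; [set j]; [set i; j]].
Proof. by rewrite /edge_line imsetU1 imset_set1 setUC. Qed.

Lemma card_vertices : #|vertices| = n.
Proof. by rewrite /vertices card_draws card_ord bin1. Qed.

Lemma card_edges : #|edges| = 'C(n, 2).
Proof. by rewrite /edges card_draws card_ord. Qed.

Lemma vertex_notin_edges S i : S \subset edges -> [set i] \notin S.
Proof. by move=> /subsetP SE; apply/negP => /SE; rewrite inE cards1. Qed.

Lemma edge_notin_vertices e : e \in edges -> e \notin vertices.
Proof. by rewrite !inE => /eqP ->. Qed.

Lemma graph_linear_space S : S \subset edges ->
  linear_space (vertices :|: S) (edge_line @: S).
Proof.
move=> SE; split.
  move=> _ /imsetP [e eS ->]; split.
    rewrite subUset sub1set inE eS orbT /=.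
    by apply/subsetP => _ /imsetP [i _ ->]; rewrite !inE cards1.
  have := subsetP SE e eS; rewrite inE => /eqP e2.
  rewrite cardsU1 card_imset ?e2; last exact: set1_inj.
  suff -> : e \notin [set [set i] | i in e] by [].
  by apply/imsetP => -[i _ ei]; rewrite ei cards1 in e2.
move=> _ _ /imsetP [e eS ->] /imsetP [f fS ->].
have [->//|ef] := eqVneq e f.
have sub : edge_line e :&: edge_line f \subset [set [set i] | i in e :&: f].
  apply/subsetP => x; rewrite !inE => /andP [/orP [/eqP ->|/imsetP [i ie ->]]].
    case/orP; first by rewrite (negbTE ef).
    by case/imsetP => i _ E; have := vertex_notin_edges i SE; rewrite -E eS.
  case/orP => [/eqP E|]; first by have := vertex_notin_edges i SE; rewrite E fS.
  case/imsetP => j jf /set1_inj ij; apply: imset_f; by rewrite inE ie ij jf.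
move/leq_trans=> /(_ _ (subset_leq_card sub)); rewrite card_imset; last exact: set1_inj.
move=> ef2; have := subsetP SE e eS; have := subsetP SE f fS; rewrite !inE => /eqP f2 /eqP e2.
have Ee : e :&: f = e by apply/eqP; rewrite eqEcard subsetIl e2.
have Ef : e :&: f = f by apply/eqP; rewrite eqEcard subsetIr f2.
by rewrite -Ee Ef.
Qed.

(** Stated for an arbitrary set of edges, since they are added one at a time. *)
Lemma graph_matroid_in_class (C : matroid_class) S :
  contains_uniform 3 C -> closed_under_principal_extensions C ->
  2 < n -> S \subset edges ->
  exists M : matroid {set 'I_n},
    line_matroid M (vertices :|: S) (edge_line @: S) /\ C _ M.
Proof.
move=> Cunif Cext n3; move cS : #|S| => c; elim: c S cS => [|c IH] S cS SE.
  have [M mM] := line_matroid_exists (graph_linear_space SE); exists M; split=> //.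
  apply: Cunif; have [gM iM] := mM; move/eqP: cS; rewrite cards_eq0 => /eqP S0.
  rewrite /uniform gM S0 setU0 card_vertices; split=> // X; rewrite iM S0 imset0 setU0.
  by rewrite inE andbT.
have [e eS] : exists e, e \in S by apply/card_gt0P; rewrite cS.
have S'E : S :\ e \subset edges by apply: subset_trans SE; apply: subD1set.
have [|M [mM CM]] := IH (S :\ e) _ S'E; first by apply: succn_inj; rewrite -cS (cardsD1 e S) eS.
have [M' mM'] := line_matroid_exists (graph_linear_space SE).
exists M'; split=> //; apply: Cext CM _.
have := subsetP SE e eS; rewrite inE => /cards2P [i [j [ij E]]].
have gE : vertices :|: S = e |: (vertices :|: S :\ e).
  by rewrite setUCA setD1K.
have gL : edge_line @: S = [set [set i]; [set j]; e] |: edge_line @: (S :\ e).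
  by rewrite -{1}(setD1K eS) imsetU1 {1}E edge_lineE -E.
have sL' := graph_linear_space SE.
rewrite gE gL in mM' sL'.
apply: line_matroid_extension (graph_linear_space S'E) mM sL' mM' _ _ _ _.
- by rewrite !inE cards1.
- by rewrite !inE cards1.
- by apply: contraNneq ij => /set1_inj ->.
- by rewrite in_setU negb_or setD11 andbT edge_notin_vertices // (subsetP SE).
Qed.

(** [W] is the side with fewer vertices.  Its points are tangent edges, of which
there are at most [rho], or of the form [{i, j}] with [j] one of the at most [rho]
vertices of [W]; the choice [i = j] accounts for the vertices themselves. *)
Lemma light_side_small (U W : {set {set 'I_n}}) rho :
  U :|: W = vertices :|: edges -> [disjoint U & W] ->
  #|tangent_points (edge_line @: edges) U W| <= rho ->
  #|tangent_points (edge_line @: edges) W U| <= rho ->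
  #|[set i | [set i] \in W]| <= #|[set i | [set i] \in U]| ->
  #|W| <= rho + n * rho.
Proof.
set DU := tangent_points _ U W; set DW := tangent_points _ W U.
set A := [set i | [set i] \in U]; set B := [set i | [set i] \in W].
move=> UW dis DUr DWr BA.
have vUW i : ([set i] \in U) || ([set i] \in W).
  by rewrite -in_setU UW !inE cards1.
have eUW i j : i != j -> ([set i; j] \in U) || ([set i; j] \in W).
  by move=> ij; rewrite -in_setU UW !inE cards2 ij.
have line i j : i != j -> edge_line [set i; j] \in edge_line @: edges.
  by move=> ij; rewrite imset_f // inE cards2 ij.
have B_rho : #|B| <= rho.
  have [BD|] := boolP (#|B| <= #|DW|); first exact: leq_trans BD DWr.
  rewrite -ltnNge -[in X in X -> _](card_imset _ (@set1_inj 'I_n)) => hB.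
  have /subsetPn [_ /imsetP [j jB ->] jD] : ~~ ([set [set i] | i in B] \subset DW).
    by apply: contraL hB => /subset_leq_card; rewrite leqNgt.
  apply: (leq_trans BA); apply: leq_trans DUr.
  rewrite -(card_imset _ (@set1_inj 'I_n)) subset_leq_card //.
  apply/subsetP => _ /imsetP [i iA ->].
  rewrite !inE in iA jB jD; rewrite inE iA /=.
  have ij : i != j.
    by apply: contraTneq jB => <-; rewrite (disjointFr dis iA).
  apply/exists_inP; exists (edge_line [set i; j]); first exact: line.
  rewrite edge_lineE; rewrite !inE eqxx /=.
  (* Otherwise the line through [i] and [j] would be tangent to [W] at [j]. *)
  have eW : [set i; j] \in W.
    have /orP [eU|//] := eUW i j ij.
    case/negP: jD; rewrite jB /=; apply/exists_inP.
    exists (edge_line [set i; j]); first exact: line.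
    rewrite edge_lineE !inE eqxx orbT /=; apply/subsetP => x; rewrite !inE.
    by case/andP => /negbTE ->; rewrite orbF => /orP [] /eqP ->.
  apply/subsetP => x; rewrite !inE.
  by case/andP => /negbTE ->; rewrite /= => /orP [] /eqP ->.
pose P := [set [set p.1; p.2] | p in setX [set: 'I_n] B].
have cP : #|P| <= n * rho.
  apply: leq_trans (leq_imset_card _ _) _.
  by rewrite cardsX cardsT card_ord leq_mul.
suff WDP : W \subset DW :|: P.
  apply: leq_trans (subset_leq_card WDP) _; apply: leq_trans (leq_card_setU _ _) _.
  exact: leq_add.
apply/subsetP => x xW.
have PB i j : [set j] \in W -> [set i; j] \in P.
  by move=> jW; apply/imsetP; exists (i, j) => //; rewrite !inE.
have : x \in vertices :|: edges by rewrite -UW inE xW orbT.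
rewrite !in_setU => /orP []; rewrite inE.
  by case/cards1P => i E; rewrite E in xW *; rewrite -[[set i] in X in _ || X]setUid PB ?orbT.
case/cards2P => i [j [ij E]]; rewrite {x}E in xW *.
have /orP [iU|iW] := vUW i; last by rewrite setUC PB ?orbT.
have /orP [jU|jW] := vUW j; last by rewrite PB ?orbT.
apply/orP; left; rewrite inE xW /=; apply/exists_inP.
exists (edge_line [set i; j]); first exact: line.
rewrite edge_lineE !inE eqxx !orbT /=; apply/subsetP => x; rewrite !inE.
by case/andP => /negbTE ->; rewrite orbF => /orP [] /eqP ->.
Qed.

End CompleteGraph.

(** * Unbounded decomposition-width *)

Theorem corollary4p2 (C : matroid_class) :
  contains_uniform 3 C ->
  closed_under_principal_extensions C ->
  ~ pigeonhole C.
Proof.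
move=> Cunif Cext /(_ 7 isT) [rho hrho].
(* This gives [6 * (rho + n * rho) < n ^ 2], against [light_side_small]. *)
pose n := 6 * rho.+1; have n3 : 2 < n by rewrite /n; lia.
have [M [mM CM]] := graph_matroid_in_class Cunif Cext n3 (subxx (edges n)).
set E := _ :|: _ in mM; set L := _ @: _ in mM.
have [gM iM] := mM; have sL : linear_space E L := graph_linear_space (subxx _).
have rk X : rank M X <= 3 := line_matroid_rank_le3 X mM.
(* The crude bound 3 + 3 on the connectivity is enough, hence the constant 7. *)
have bw : branch_width M <= 7.
  apply: branch_width_le => U; rewrite /lambda.
  have := rk U; have := rk (ground M :\: U); lia.
have cE : n * n <= 2 * #|ground M|.
  have dis : vertices n :&: edges n = set0.
    apply/setP => x; rewrite in_set0 in_setI; apply/negP => /andP [xv /edge_notin_vertices].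
    by rewrite xv.
  rewrite gM cardsU dis cards0 card_vertices card_edges subn0.
  have := bin_ffact n 2; rewrite ffactnS ffactn1 /factorial; nia.
have E1 : 1 < #|ground M| by nia.
have [D hD] := decomposition_width_attained E1 (hrho _ _ CM bw).
have [u [v [uv]]] := balanced_edge D E1.
have symm : symmetric (@dec_adj _ _ D) by have [[]] := dec_subcubic D.
have vu : dec_adj v u by rewrite symm.
have small x y : dec_adj x y -> #|tangent_points L (edge_side (D := D) x y) (edge_side y x)| <= rho.
  move=> xy; rewrite (edge_sideC xy) gM; apply: leq_trans (tangent_points_classes sL mM _) _.
    by rewrite -gM; apply/subsetP => z; rewrite inE => /andP [].
  by apply: hD; apply/imsetP; exists (x, y).
have := small _ _ uv; have := small _ _ vu.
have : edge_side (D := D) u v :|: edge_side v u = E.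
  rewrite (edge_sideC uv) -gM -[RHS](setID (ground M) (edge_side (D := D) u v)).
  congr (_ :|: _); apply/esym/setIidPr/subsetP => z.
  by rewrite inE => /andP [].
have : [disjoint edge_side (D := D) u v & edge_side v u].
  by rewrite (edge_sideC uv) -setI_eq0 setIDA setIC setDIl setDv setI0.
move: (edge_side u v) (edge_side v u) => U W dis UW sW sU hU hW.
have : n * n <= 6 * (rho + n * rho); last by rewrite /n; nia.
have [le|le] := leqP #|[set i | [set i] \in W]| #|[set i | [set i] \in U]|.
  have := light_side_small UW dis sU sW le; lia.
rewrite setUC in UW; rewrite disjoint_sym in dis.
have := light_side_small UW dis sW sU (ltnW le); lia.
Qed.
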